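(* Assume that the graph $\mathcal{G}$ is connected and that $f$ is strictly convex in $x$. If there exists $x_{eq}\in\mathbb{R}^{ln}$ satisfying the KKT conditions of the distributed optimization problem (i.e. $x_{eq}$ is the $x$-component of a KKT point), then the subsystem $$H_1:\quad \dot{x}=-\nabla_x f(x)+u_x+u_{H_1},\qquad \dot a_{iq}=d_{iq}\big(e_{iq}^Te_{iq}+\dot e_{iq}^T\dot e_{iq}\big)\ (i\in\mathcal N,\ q\in\mathcal N_i),\qquad y_{H_1}=x,$$ with $u_x=-(L\otimes I_l)x$ and $e_{iq}=x_i-x_q$, is passive with port variables $(\dot y_{H_1},\dot u_{H_1})$ (input $\dot u_{H_1}$, output $\dot y_{H_1}$).
   Context: Graph: $\mathcal G=(\mathcal N,\mathcal E)$ is an undirected graph, $\mathcal N=\{1,\dots,n\}$, $\mathcal N_i$ is the neighbor set of agent $i$, with coupling weights $a_{iq}=a_{qi}>0$ for $(i,q)\in\mathcal E$ and $a_{iq}=0$ otherwise; $L=D-A\in\mathbb R^{n\times n}$ is the Laplacian of $\mathcal G$ with adjacency matrix $A=(a_{iq})$ and degree matrix $D$. In $H_1$ the weights $a_{iq}$ are time-varying (so $L$ is too), with adaptive gains $d_{iq}=d_{qi}>0$; the right-hand side of the weight law, as a function of $(e_{iq},\dot e_{iq})$, is assumed Lipschitz continuous. Problem: with $x_i=[x_{i1},\dots,x_{il}]^T\in\mathbb R^l$ and $x=[x_1^T,\dots,x_n^T]^T\in\mathbb R^{ln}$, minimize $f(x)=\sum_{i=1}^n f_i(x_i)$ subject to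 $x_{ik}=x_{qk}$ for all $k=1,\dots,l$ and $i,q\in\mathcal N$, and $g_j(x_{ik})\le 0$ for $j=1,\dots,m_g^{ik}$, $k=1,\dots,l$, $i\in\mathcal N$. The functions $f_i:\mathbb R^l\to\mathbb R$ are twice differentiable and strongly convex, $g_j:\mathbb R\to\mathbb R$ are convex (and differentiable). Slater's condition is assumed. KKT conditions for $(x^*,\alpha^*,\theta^* )$, for all $i\in\mathcal N$, $k$, $j$: $\nabla_{x_{ik}}f_i(x^*_{ik})+\sum_{q\in\mathcal N_i}a_{iq}(\alpha^*_{ik}-\alpha^*_{qk})+\sum_{j=1}^{m_g^{ik}}(\theta^{ik}_j)^*\nabla g_j(x^*_{ik})=0$; $g_j(x^*_{ik})\le0$; $(\theta^{ik}_j)^*\ge0$; $(\theta^{ik}_j)^*g_j(x^*_{ik})=0$; $x^*_{ik}=x^*_{qk}$ for all $i,q\in\mathcal N$. Passivity: a system with port input $v$ and port output $w$ is passive if there is a positive semidefinite, continuously differentiable storage function $V$ such that $\dot V\le v^Tw$ along trajectories. Here the port variables are time derivatives, i.e. the inequality reads $\dot V\le \dot u_{H_1}^T\dot y_{H_1}$; the storage function may be of Krasovskii type (depending on the state through $\dot x$) and may depend on the coupling weights.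
   Formalization: The weight law is quadratic, so it cannot be globally Lipschitz; it is assumed Lipschitz only on a set of pairs (e, ė), and passivity is claimed for trajectories whose pairs (e_iq, ė_iq) stay in that set, with a storage function that may depend on the set. *)

(* Defs.v *)
From HB Require Import structures.
From mathcomp Require Import all_boot all_order all_algebra.
From mathcomp Require Import all_classical all_reals all_analysis.

Set Implicit Arguments.
Unset Strict Implicit.
Unset Printing Implicit Defensive.

Import Order.TTheory GRing.Theory Num.Theory.
Import numFieldNormedType.Exports.

Local Open Scope classical_set_scope.
Local Open Scope ring_scope.

(* A vector x = [x_1^T, ..., x_n^T]^T of R^(l n) is represented by the n x l
   matrix whose i-th row is x_i^T. The entry x i k is x_ik, the Euclidean inner
   product is the entrywise one, and (M (x) I_l) x is the matrix M *m x. *)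

Definition dot (R : realType) (m n : nat) (A B : 'M[R]_(m, n)) : R :=
  \sum_i \sum_j A i j * B i j.

Definition grad (R : realType) (m n : nat) (h : 'M[R]_(m, n) -> R)
    (x : 'M[R]_(m, n)) : 'M[R]_(m, n) :=
  \matrix_(i, j) 'D_(delta_mx i j) h x.

Definition twice_differentiable (R : realType) (m n : nat)
    (h : 'M[R]_(m, n) -> R) : Prop :=
  (forall x, differentiable h x) /\ (forall x, differentiable (grad h) x).

Definition strictly_convex (R : realType) (m n : nat)
    (h : 'M[R]_(m, n) -> R) : Prop :=
  forall (x y : 'M[R]_(m, n)) (t : R), x != y -> 0 < t < 1 ->
    h (t *: x + (1 - t) *: y) < t * h x + (1 - t) * h y.

Definition strongly_convex (R : realType) (m n : nat)
    (h : 'M[R]_(m, n) -> R) : Prop :=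
  exists2 mu : R, 0 < mu &
    forall (x y : 'M[R]_(m, n)) (t : R), 0 <= t <= 1 ->
      h (t *: x + (1 - t) *: y) <=
      t * h x + (1 - t) * h y - mu / 2 * t * (1 - t) * dot (x - y) (x - y).

(* On the finite-dimensional spaces used below, continuity of p |-> 'd V p h
   for each direction h is continuity of the differential. *)
Definition continuously_differentiable (R : realType) (X : normedModType R)
    (V : X -> R) : Prop :=
  (forall p : X, differentiable V p) /\
  (forall h : X, continuous (fun p : X => 'd V p h)).

Definition undirected_graph (n : nat) (E : rel 'I_n) : Prop :=
  symmetric E /\ irreflexive E.

Definition connected_graph (n : nat) (E : rel 'I_n) : Prop :=
  forall i q : 'I_n, connect E i q.

Definition coupling_weights (R : realType) (n : nat) (E : rel 'I_n)
    (a : 'M[R]_n) : Prop :=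
  [/\ forall i q, a i q = a q i,
      forall i q, E i q -> 0 < a i q &
      forall i q, ~~ E i q -> a i q = 0].

Definition laplacian (R : realType) (n : nat) (a : 'M[R]_n) : 'M[R]_n :=
  diag_mx (\row_i \sum_q a i q) - a.

Definition cost (R : realType) (n l : nat) (fi : 'I_n -> 'rV[R]_l -> R)
    (x : 'M[R]_(n, l)) : R :=
  \sum_i fi i (row i x).

(* The constraints on x_ik are g_j for j < mg i k, with indices starting
   from 0. *)

Definition slater (R : realType) (n l : nat) (g : nat -> R -> R)
    (mg : 'I_n -> 'I_l -> nat) : Prop :=
  exists x : 'M[R]_(n, l),
    (forall i q k, x i k = x q k) /\
    (forall i k (j : 'I_(mg i k)), g j (x i k) < 0).

Definition KKT (R : realType) (n l : nat) (E : rel 'I_n) (a : 'M[R]_n)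
    (fi : 'I_n -> 'rV[R]_l -> R) (g : nat -> R -> R)
    (mg : 'I_n -> 'I_l -> nat) (x alpha : 'M[R]_(n, l))
    (theta : 'I_n -> 'I_l -> nat -> R) : Prop :=
  [/\ forall i k,
        grad (fi i) (row i x) 0 k
        + \sum_(q | E i q) a i q * (alpha i k - alpha q k)
        + \sum_(j < mg i k) theta i k j * derive1 (g j) (x i k) = 0,
      forall i k (j : 'I_(mg i k)), g j (x i k) <= 0,
      forall i k (j : 'I_(mg i k)), 0 <= theta i k j,
      forall i k (j : 'I_(mg i k)), theta i k j * g j (x i k) = 0 &
      forall i q k, x i k = x q k].

(* A system is given by its trajectories: [Sys t0 t1 z v w] states that on the
   time interval ]t0, t1[ the curve z of states is a trajectory with port input
   v and port output w. Positive semidefiniteness of the storage function is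
   relative to the set Eq of rest states: V is nonnegative and vanishes at a
   rest state. *)
Definition passive (R : realType) (X : normedModType R) (m n : nat)
    (Sys : R -> R -> (R -> X) -> (R -> 'M[R]_(m, n)) -> (R -> 'M[R]_(m, n)) ->
           Prop)
    (Eq : set X) : Prop :=
  exists V : X -> R,
    [/\ continuously_differentiable V,
        forall p, 0 <= V p,
        exists2 p, Eq p & V p = 0 &
        forall (t0 t1 : R) z v w, Sys t0 t1 z v w ->
          forall t, t0 < t < t1 ->
            derive1 (fun s => V (z s)) t <= dot (v t) (w t)].

Definition edge_error (R : realType) (n l : nat) (x : 'M[R]_(n, l))
    (i q : 'I_n) : 'rV[R]_l :=
  row i x - row q x.

(* The right-hand side of the weight law, as a function of p = (e, de/dt). *)
Definition weight_law (R : realType) (l : nat) (d : R)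
    (p : 'rV[R]_l * 'rV[R]_l) : R :=
  d * (dot p.1 p.1 + dot p.2 p.2).

Definition H1_solution (R : realType) (n l : nat) (E : rel 'I_n)
    (d : 'M[R]_n) (f : 'M[R]_(n, l) -> R) (t0 t1 : R)
    (x : R -> 'M[R]_(n, l)) (a : R -> 'M[R]_n) (u y : R -> 'M[R]_(n, l)) :
    Prop :=
  forall t, t0 < t < t1 ->
    [/\ [/\ derivable x t 1, derivable a t 1 & derivable u t 1],
        coupling_weights E (a t),
        derive1 x t = - grad f (x t) + (- (laplacian (a t) *m x t)) + u t,
        forall i q, E i q ->
          derive1 (fun s => a s i q) t =
          weight_law (d i q) (edge_error (x t) i q,
                              derive1 (fun s => edge_error (x s) i q) t) &
        y t = x t].

Definition edges_in (R : realType) (n l : nat) (E : rel 'I_n)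
    (Omega : set ('rV[R]_l * 'rV[R]_l)) (t0 t1 : R)
    (x : R -> 'M[R]_(n, l)) : Prop :=
  forall t, t0 < t < t1 -> forall i q, E i q ->
    Omega (edge_error (x t) i q, derive1 (fun s => edge_error (x s) i q) t).

(* With du/dt as port input, u is part of the state of H1. Since
   u = dx/dt + grad f(x) + (L (x) I_l) x, the coordinates (x, a, u) of this
   state are exchanged for (x, a, dx/dt), those of a Krasovskii-type storage
   function.

   The weight law is quadratic, so it is Lipschitz continuous only on bounded
   sets of pairs (e, de/dt). Its Lipschitz continuity is therefore assumed on
   an operating region Omega, in which the pairs (e_iq, de_iq/dt) evolve. *)
Definition H1 (R : realType) (n l : nat) (E : rel 'I_n) (d : 'M[R]_n)
    (f : 'M[R]_(n, l) -> R) (Omega : set ('rV[R]_l * 'rV[R]_l)) (t0 t1 : R)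
    (z : R -> 'M[R]_(n, l) * 'M[R]_n * 'M[R]_(n, l))
    (v w : R -> 'M[R]_(n, l)) : Prop :=
  exists x a u y,
    [/\ H1_solution E d f t0 t1 x a u y,
        edges_in E Omega t0 t1 x,
        z = (fun t => (x t, a t, derive1 x t)),
        v = derive1 u &
        w = derive1 y].

(* At a consensus state at rest the weights are constant and can be any
   coupling weights. *)
Definition H1_rest (R : realType) (n l : nat) (E : rel 'I_n)
    (xeq : 'M[R]_(n, l)) : set ('M[R]_(n, l) * 'M[R]_n * 'M[R]_(n, l)) :=
  [set p | [/\ p.1.1 = xeq, coupling_weights E p.1.2 & p.2 = 0]].

(* Main.v *)
(* Differentiating the state equation along a trajectory gives
     x'' = - (Hess f) x' - L x' - L' x + u',
   where x'^T (Hess f) x' >= 0 by convexity and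
     x'^T L x' = 1/2 sum a |e'|^2,   x'^T L' x = 1/2 sum d (|e|^2 + |e'|^2) e^T e',
   the sums being over ordered pairs of neighbors. The storage function is
     V = |x'|^2 / 2 + sum (d/8 |e|^4 + max(0, d M - a)^2 / (4 d)),
   where M bounds |e|^2 + |e'|^2: the law of the weights is quadratic, so the
   region on which it is Lipschitz continuous is bounded. The quartic term
   compensates the part |e|^2 e^T e' of the drift x'^T L' x. The other part,
   |e'|^2 e^T e', is dominated by the damping a |e'|^2 once a >= d M; as long as
   a < d M, the growth of a makes the last term decrease, and this supplies the
   missing damping. V vanishes at the rest states whose weights exceed d M. *)

Require Import Defs.
From HB Require Import structures.
From mathcomp Require Import all_boot all_order all_algebra.
From mathcomp Require Import all_classical all_reals all_analysis.
From mathcomp Require Import ring lra.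

Set Implicit Arguments.
Unset Strict Implicit.
Unset Printing Implicit Defensive.

Import Order.TTheory GRing.Theory Num.Theory.
Import numFieldNormedType.Exports.

Local Open Scope classical_set_scope.
Local Open Scope ring_scope.

(** * The entrywise inner product and the sup norm *)

Lemma dot_ge0 (R : realType) (m n : nat) (A : 'M[R]_(m, n)) : 0 <= dot A A.
Proof. by apply: sumr_ge0 => i _; apply: sumr_ge0 => j _; exact: sqr_ge0. Qed.

Lemma dot0l (R : realType) (m n : nat) (A : 'M[R]_(m, n)) : dot 0 A = 0.
Proof. by apply: big1 => i _; apply: big1 => j _; rewrite mxE mul0r. Qed.

Lemma dot_row (R : realType) (n l : nat) (A B : 'M[R]_(n, l)) :
  dot A B = \sum_i dot (row i A) (row i B).
Proof.
apply: eq_bigr => i _; rewrite /dot big_ord1.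
by apply: eq_bigr => k _; rewrite !mxE.
Qed.

Lemma dotDr (R : realType) (m n : nat) (A B C : 'M[R]_(m, n)) :
  dot A (B + C) = dot A B + dot A C.
Proof.
rewrite /dot -big_split; apply: eq_bigr => i _ /=.
by rewrite -big_split; apply: eq_bigr => j _ /=; rewrite mxE mulrDr.
Qed.

Lemma dotNr (R : realType) (m n : nat) (A B : 'M[R]_(m, n)) :
  dot A (- B) = - dot A B.
Proof.
rewrite /dot -sumrN; apply: eq_bigr => i _ /=.
by rewrite -sumrN; apply: eq_bigr => j _ /=; rewrite mxE mulrN.
Qed.

Lemma dotC (R : realType) (m n : nat) (A B : 'M[R]_(m, n)) : dot A B = dot B A.
Proof. by apply: eq_bigr => i _; apply: eq_bigr => j _; rewrite mulrC. Qed.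

(** The norm of a matrix is the largest absolute value of its entries, so its square is one of the
    nonnegative terms of [dot A A]. *)
Lemma le_norm_dot (R : realType) (m n : nat) (A : 'M[R]_(m, n)) :
  `|A| ^+ 2 <= dot A A.
Proof.
rewrite [`|A|]/Num.Def.normr /=.
have [->|/mx_norm_neq0[[i j] ->]] := eqVneq (mx_norm A) 0.
  by rewrite expr0n dot_ge0.
rewrite real_normK ?num_real// /dot (bigD1 i)//= (bigD1 j)//= -expr2 -addrA.
rewrite lerDl addr_ge0 //; first by apply: sumr_ge0 => k _; exact: sqr_ge0.
by apply: sumr_ge0 => k _; apply: sumr_ge0 => k' _; exact: sqr_ge0.
Qed.

Lemma dot_lower_bound (R : realType) (m n : nat) (A B : 'M[R]_(m, n)) :
  - (dot A A + dot B B) / 2 <= dot A B.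
Proof.
rewrite ler_pdivrMr // lerNl -subr_ge0.
have -> : dot A A + dot B B - - (dot A B * 2) = dot (A + B) (A + B).
  rewrite /dot mulr_suml opprK -!big_split; apply: eq_bigr => i _ /=.
  rewrite mulr_suml -!big_split; apply: eq_bigr => j _ /=.
  by rewrite mxE; ring.
exact: dot_ge0.
Qed.

(** * Boundedness of the operating region *)

Lemma norm2_le_weight_law1 (R : realType) (l : nat) (p : 'rV[R]_l * 'rV[R]_l) :
  `|p| ^+ 2 <= weight_law 1 p.
Proof.
rewrite /weight_law mul1r prod_normE.
case: (leP `|p.1| `|p.2|) => _; apply: le_trans (le_norm_dot _) _.
  by rewrite lerDr dot_ge0.
by rewrite lerDl dot_ge0.
Qed.

(** A quadratic law grows faster than a Lipschitz bound allows: from a base point p0 it can increase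
    only linearly in [|p|], while it dominates [|p|^2]. *)
Lemma weight_law_lipschitz_bounded (R : realType) (l : nat) (d : R)
    (Omega : set ('rV[R]_l * 'rV[R]_l)) :
  0 < d -> [lipschitz weight_law d p | p in Omega] ->
  exists2 M : R, 0 <= M & forall p, Omega p -> weight_law 1 p <= M.
Proof.
move=> d0 /pinfty_ex_gt0[K K0 lipK].
have [[p0 Op0]|nO] := pselect (exists p0, Omega p0); last first.
  by exists 0 => // p Op; case: nO; exists p.
have wlE p : weight_law d p = d * weight_law 1 p.
  by rewrite /weight_law mul1r.
have wl0 p : 0 <= weight_law 1 p :> R.
  exact: le_trans (sqr_ge0 _) (norm2_le_weight_law1 p).
pose c := K / d.
have c0 : 0 < c by rewrite divr_gt0.
(* With W = [weight_law 1], the bound is W p <= W p0 + c (|p| + |p0|). Since 2 c |p| <= |p|^2 + c^2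
   <= W p + c^2, half of W p is absorbed on the left; doubling gives this constant. *)
exists (2 * (weight_law 1 p0 + c * `|p0|) + c ^+ 2).
  by rewrite addr_ge0 ?sqr_ge0// mulr_ge0// addr_ge0// mulr_ge0// ltW.
move=> p Op.
have h1 : d * (weight_law 1 p - weight_law 1 p0) <= K * (`|p| + `|p0|).
  rewrite mulrBr -!wlE.
  apply: le_trans (ler_norm _) _; apply: le_trans (lipK (p, p0) _) _ => //=.
  by apply: ler_wpM2l; [exact: ltW|exact: ler_normB].
have h2 : weight_law 1 p - weight_law 1 p0 <= c * (`|p| + `|p0|).
  by rewrite -(ler_pM2l d0) /c mulrA mulrCA divff ?gt_eqF// mulr1.
have := norm2_le_weight_law1 p.
have := sqr_ge0 (`|p| - c).
nra.
Qed.

(** * The bilinear form of the Laplacian *)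

Lemma laplacian_mulE (R : realType) (n l : nat) (a : 'M[R]_n)
    (x : 'M[R]_(n, l)) i k :
  (laplacian a *m x) i k = \sum_q a i q * (x i k - x q k).
Proof.
rewrite /laplacian mulmxBl mul_diag_mx !mxE mulr_suml -sumrB.
by apply: eq_bigr => q _; rewrite mulrBr.
Qed.

(** Exchanging i and q in the double sum and using the symmetry of the weights gives a second
    expression of the form; averaging the two produces the edge differences of y and the factor
    1/2. *)
Lemma dot_laplacian (R : realType) (n l : nat) (a : 'M[R]_n)
    (x y : 'M[R]_(n, l)) : (forall i q, a i q = a q i) ->
  dot y (laplacian a *m x) =
  2^-1 * \sum_i \sum_q a i q * dot (edge_error y i q) (edge_error x i q).
Proof.
move=> asym.
pose S := \sum_i \sum_q a i q * \sum_k y i k * (x i k - x q k).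
have SE : dot y (laplacian a *m x) = S.
  apply: eq_bigr => i _; under eq_bigr do rewrite laplacian_mulE mulr_sumr.
  rewrite exchange_big; apply: eq_bigr => q _ /=.
  by rewrite mulr_sumr; apply: eq_bigr => k _; rewrite mulrCA.
have SE' : S = \sum_i \sum_q a i q * \sum_k y q k * (x q k - x i k).
  rewrite /S exchange_big; apply: eq_bigr => i _; apply: eq_bigr => q _.
  by rewrite asym.
suff -> : \sum_i \sum_q a i q * dot (edge_error y i q) (edge_error x i q) = S + S.
  by rewrite SE; field.
rewrite {2}SE' /S -big_split; apply: eq_bigr => i _ /=.
rewrite -big_split; apply: eq_bigr => q _ /=.
rewrite -mulrDr -big_split /dot big_ord1; congr (_ * _).
by apply: eq_bigr => k _ /=; rewrite !mxE; ring.
Qed.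

(** * Closure properties of continuously differentiable functions *)

Section continuous_differentiability.
Context {R : realType} {X : normedModType R}.
Implicit Types V W : X -> R.

Lemma continuously_differentiable_linear V :
  linear V -> continuous V -> continuously_differentiable V.
Proof.
move=> linV contV.
pose f : {linear X -> R} :=
  HB.pack V (GRing.isLinear.Build _ _ _ _ V linV).
have diffV p : differentiable V p by exact: (@linear_differentiable _ _ _ f).
split=> // h; rewrite (_ : (fun p => _) = cst (V h)); first exact: cst_continuous.
apply/funext => p; exact: (congr1 (fun g => g h) (@diff_lin _ _ _ f p contV)).
Qed.

Lemma continuously_differentiable_cst (c : R) :
  continuously_differentiable (fun _ : X => c).
Proof.
split=> [p|h]; first exact: differentiable_cst.
rewrite (_ : (fun p => _) = cst 0); first exact: cst_continuous.
by apply/funext => p; rewrite diff_cst.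
Qed.

Lemma continuously_differentiableD V W :
  continuously_differentiable V -> continuously_differentiable W ->
  continuously_differentiable (fun p => V p + W p).
Proof.
move=> [dV cV] [dW cW]; split=> [p|h]; first exact: differentiableD.
rewrite (_ : (fun p => _) = (fun p => 'd V p h + 'd W p h)).
  by move=> p; apply: cvgD; [exact: cV|exact: cW].
by apply/funext => p; rewrite diffD.
Qed.

Lemma continuously_differentiableB V W :
  continuously_differentiable V -> continuously_differentiable W ->
  continuously_differentiable (fun p => V p - W p).
Proof.
move=> [dV cV] [dW cW]; split=> [p|h]; first exact: differentiableB.
rewrite (_ : (fun p => _) = (fun p => 'd V p h - 'd W p h)).
  by move=> p; apply: cvgB; [exact: cV|exact: cW].
by apply/funext => p; rewrite diffB.
Qed.

Lemma continuously_differentiableM V W :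
  continuously_differentiable V -> continuously_differentiable W ->
  continuously_differentiable (fun p => V p * W p).
Proof.
move=> [dV cV] [dW cW]; split=> [p|h]; first exact: differentiableM.
rewrite (_ : (fun p => _) = (fun p => V p * 'd W p h + W p * 'd V p h)).
  by move=> p; apply: cvgD; apply: cvgM; do ?[exact: cV|exact: cW];
    exact: differentiable_continuous.
by apply/funext => p; rewrite diffM.
Qed.

Lemma continuously_differentiable_sum (I : Type) (r : seq I) (P : pred I)
    (V : I -> X -> R) :
  (forall i, P i -> continuously_differentiable (V i)) ->
  continuously_differentiable (fun p => \sum_(i <- r | P i) V i p).
Proof.
move=> cV; elim: r => [|i r IHr].
  under eq_fun do rewrite big_nil.
  exact: continuously_differentiable_cst.
under eq_fun do rewrite big_cons.
case: (boolP (P i)) => [Pi|_]; last exact: IHr.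
exact: (continuously_differentiableD (cV i Pi) IHr).
Qed.

Lemma continuously_differentiable_comp (phi dphi : R -> R) V :
  (forall s : R, is_derive s 1 phi (dphi s)) -> continuous dphi ->
  continuously_differentiable V ->
  continuously_differentiable (fun p => phi (V p)).
Proof.
move=> phi_der cdphi [dV cV].
have dphid s : differentiable phi s by apply/derivable1_diffP.
split=> [p|h]; first exact: (differentiable_comp (dV p)).
rewrite (_ : (fun p => _) = (fun p => 'd V p h * dphi (V p))).
  move=> p; apply: cvgM; first exact: cV.
  by apply: (@continuous_comp _ _ _ V dphi); [exact: differentiable_continuous|
    exact: cdphi].
apply/funext => p; rewrite (diff_comp (dV p) (dphid (V p))) /= deriv1E//.
by rewrite derive1E derive_val.
Qed.

End continuous_differentiability.

(** * The squared positive part *)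

(** Squaring removes the kink of the maximum at 0, which makes the weight term of the storage
    function continuously differentiable. *)
Definition pos_part_sqr (R : realType) (s : R) : R := Num.max 0 s ^+ 2.

(** Whatever the signs of s and h + s, the first-order remainder is at most h^2, so the difference
    quotient is within [|h|] of its limit, also at s = 0. *)
Lemma is_derive_pos_part_sqr (R : realType) (s : R) :
  is_derive s 1 (@pos_part_sqr R) (2 * Num.max 0 s).
Proof.
have quad (h : R) : h != 0 ->
    `|2 * Num.max 0 s - h^-1 *: (pos_part_sqr (h%:A + s) - pos_part_sqr s)|
    <= `|h|.
  move=> h0; rewrite -(ler_pM2l (_ : 0 < `|h|)) ?normr_gt0// -normrM mulrBr.
  rewrite [_ *: _]/(_ * _) mulVKf// -expr2 real_normK ?num_real//.
  rewrite /pos_part_sqr [h%:A]mulr1 ler_norml.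
  by case: (leP 0 s) => ?; case: (leP 0 (h + s)) => ?; apply/andP; split; nra.
suff : h^-1 *: (pos_part_sqr (h%:A + s) - pos_part_sqr s) @[h --> 0^'] -->
    2 * Num.max 0 s.
  by move=> lim; apply: DeriveDef; [apply/cvg_ex; eexists; exact: lim|
    exact: cvg_lim lim].
apply/cvgrPdist_le => e e0; near=> h.
apply: le_trans (quad h _) _; first by near: h; exact: nbhs_dnbhs_neq.
by near: h; exact: dnbhs0_le.
Unshelve. all: by end_near. Qed.

Lemma continuous_double_pos_part (R : realType) :
  continuous (fun s : R => 2 * Num.max 0 s).
Proof.
move=> s; apply: cvgM; first exact: cvg_cst.
by apply: continuous_max; [exact: cst_continuous|exact: cvg_id].
Qed.

(** * Monotonicity of the gradient of a convex function *)

Section convex_gradient.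
Context {R : realType} {m n : nat}.
Implicit Types (h : 'M[R]_(m, n) -> R) (x y : 'M[R]_(m, n)).

Lemma strongly_convexW h : strongly_convex h ->
  forall x y (t : R), 0 <= t <= 1 ->
    h (t *: x + (1 - t) *: y) <= t * h x + (1 - t) * h y.
Proof.
move=> [mu mu0 hconv] x y t /[dup] t01 /andP[t0 t1].
apply: le_trans (hconv x y t t01) _; rewrite gerBl.
rewrite !mulr_ge0 ?dot_ge0 ?subr_ge0 ?invr_ge0//; exact: ltW.
Qed.

Lemma derive_dot_grad h x w : differentiable h x ->
  'D_w h x = dot w (grad h x).
Proof.
move=> dh; rewrite deriveE// {1}(matrix_sum_delta w) linear_sum.
apply: eq_bigr => i _; rewrite linear_sum; apply: eq_bigr => j _.
by rewrite linearZ /= mxE deriveE.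
Qed.

Lemma convex_derive_le h : (forall x, differentiable h x) ->
  (forall x y (t : R), 0 <= t <= 1 ->
    h (t *: x + (1 - t) *: y) <= t * h x + (1 - t) * h y) ->
  forall x y, 'D_(y - x) h x <= h y - h x.
Proof.
move=> dh hconv x y.
(* Convexity bounds the difference quotient only for 0 < s <= 1, hence the limit from the right. *)
have lim : s^-1 *: (h (s *: (y - x) + x) - h x) @[s --> 0^'+] -->
    'D_(y - x) h x.
  have dhx : derivable h x (y - x) by exact: diff_derivable.
  by apply: cvg_dnbhs_at_right; exact: dhx.
apply: (cvgr_to_le lim); near=> s.
have s0 : 0 < s by near: s; exact: nbhs_right_gt.
have s1 : s <= 1 by near: s; exact: nbhs_right_le.
rewrite [_ *: _]/(_ * _) ler_pdivrMl//.
have := hconv y x s; rewrite (ltW s0) s1 => /(_ isT).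
have -> : s *: y + (1 - s) *: x = s *: (y - x) + x.
  by rewrite scalerBr scalerBl scale1r addrA [RHS]addrAC.
by nra.
Unshelve. all: by end_near. Qed.

(** This is the sum of the two first-order inequalities, one based at x and the other at y. *)
Lemma convex_grad_monotone h : (forall x, differentiable h x) ->
  (forall x y (t : R), 0 <= t <= 1 ->
    h (t *: x + (1 - t) *: y) <= t * h x + (1 - t) * h y) ->
  forall x y, 0 <= dot (y - x) (grad h y - grad h x).
Proof.
move=> dh hconv x y.
have := convex_derive_le dh hconv x y; have := convex_derive_le dh hconv y x.
rewrite !derive_dot_grad// => le_yx le_xy.
have -> : dot (y - x) (grad h y - grad h x) =
    - dot (x - y) (grad h y) - dot (y - x) (grad h x).
  rewrite /dot -!sumrN -big_split; apply: eq_bigr => i _ /=.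
  rewrite -!sumrN -big_split; apply: eq_bigr => j _ /=.
  by rewrite !mxE; ring.
lra.
Qed.

(* Along a curve x, (x(t+s) - x(t)) . (grad h (x(t+s)) - grad h (x(t))) / s^2
   is nonnegative by monotonicity of the gradient, hence so is its limit
   x'(t)^T (Hess h) x'(t). *)
Lemma convex_dot_derive_grad_ge0 h (z : R -> 'M[R]_(m, n)) (t : R) :
  (forall x, differentiable h x) ->
  (forall x y (t : R), 0 <= t <= 1 ->
    h (t *: x + (1 - t) *: y) <= t * h x + (1 - t) * h y) ->
  derivable z t 1 -> derivable (fun s => grad h (z s)) t 1 ->
  0 <= dot ('D_1 z t) ('D_1 (fun s => grad h (z s)) t).
Proof.
move=> dh hconv dz dg.
pose quo (w : R -> 'M[R]_(m, n)) s := s^-1 *: (w (s%:A + t) - w t).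
have coordC (w : R -> 'M[R]_(m, n)) i j : derivable w t 1 ->
    quo w s i j @[s --> 0^'] --> 'D_1 w t i j.
  move=> dw; apply: (@cvg_comp _ _ _ (quo w) (fun M => M i j) _ _ _ dw).
  exact: coord_continuous.
have lim : dot (quo z s) (quo (fun s => grad h (z s)) s) @[s --> 0^'] -->
    dot ('D_1 z t) ('D_1 (fun s => grad h (z s)) t).
  apply: cvg_big => [|i _]; first exact: add_continuous.
  apply: cvg_big => [|j _]; first exact: add_continuous.
  by apply: cvgM; exact: coordC.
apply: (cvgr_to_ge lim); apply: nearW => s.
rewrite /quo; set A := _ - _; set B := _ - _.
have -> : dot (s^-1 *: A) (s^-1 *: B) = s^-1 ^+ 2 * dot A B.
  rewrite /dot mulr_sumr; apply: eq_bigr => i _; rewrite mulr_sumr.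
  by apply: eq_bigr => j _; rewrite !mxE; ring.
by apply: mulr_ge0; [exact: sqr_ge0|exact: convex_grad_monotone].
Qed.

End convex_gradient.

(** A displacement along [delta_mx i k] changes row i only, so the other summands cancel in the
    difference quotient. *)
Lemma grad_cost (R : realType) (n l : nat) (fi : 'I_n -> 'rV[R]_l -> R)
    (x : 'M[R]_(n, l)) i k :
  grad (cost fi) x i k = grad (fi i) (row i x) 0 k.
Proof.
rewrite !mxE /derive; set q1 := fun s : R => _; set q2 := fun s : R => _.
suff -> : q1 = q2 by [].
apply/funext => s; rewrite /q1 /q2 /=.
congr (_ *: _); rewrite /cost -sumrB (bigD1 i)//= big1 ?addr0 => [|j ji].
  congr (fi i _ - _); apply/rowP => j.
  by rewrite !mxE eqxx.
rewrite (_ : row j _ = row j x) ?subrr//; apply/rowP => k'.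
by rewrite !mxE (negbTE ji) mulr0 add0r.
Qed.

(** * Derivatives of matrix-valued curves *)

Lemma is_derive_derive1 (R : realType) (V : normedModType R) (f : R -> V)
    (t : R) : derivable f t 1 -> is_derive t 1 f (derive1 f t).
Proof. by move=> df; rewrite derive1E; exact: derivableP. Qed.

Section derivative_of_matrix_curves.
Context {R : realType}.
Implicit Types t : R.

Lemma is_derive_big_sum (I : Type) (r : seq I) (P : pred I) (F : I -> R -> R)
    (dF : I -> R) t :
  (forall i, P i -> is_derive t 1 (F i) (dF i)) ->
  is_derive t 1 (fun s => \sum_(i <- r | P i) F i s) (\sum_(i <- r | P i) dF i).
Proof.
move=> der; elim: r => [|i r IHr].
  rewrite big_nil; under eq_fun do rewrite big_nil.
  exact: is_derive_cst.
rewrite big_cons; under eq_fun do rewrite big_cons.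
case: (boolP (P i)) => [Pi|_]; last exact: IHr.
exact: (is_deriveD (der i Pi) IHr).
Qed.

Lemma is_derive_mulr (f g : R -> R) (df dg : R) t :
  is_derive t 1 f df -> is_derive t 1 g dg ->
  is_derive t 1 (fun s => f s * g s) (df * g t + f t * dg).
Proof.
move=> der_f der_g; apply: (is_derive_eq (is_deriveM der_f der_g)).
by rewrite addrC; congr (_ + _); exact: mulrC.
Qed.

Lemma is_derive_mx (m n : nat) (A : R -> 'M[R]_(m, n)) (dA : 'M[R]_(m, n)) t :
  is_derive t 1 A dA <->
  forall i j, is_derive t 1 (fun s => A s i j) (dA i j).
Proof.
split=> [[derA <-] i j|derA].
  rewrite derive_mx// mxE; apply: derivableP.
  by move/derivable_mxP : derA; exact.
have dA1 : derivable A t 1 by apply/derivable_mxP => i j; exact: ex_derive.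
apply: DeriveDef => //; rewrite derive_mx//; apply/matrixP => i j.
by rewrite mxE derive_val.
Qed.

Lemma is_derive_mulmx (m n p : nat) (A : R -> 'M[R]_(m, n))
    (B : R -> 'M[R]_(n, p)) dA dB t :
  is_derive t 1 A dA -> is_derive t 1 B dB ->
  is_derive t 1 (fun s => A s *m B s) (dA *m B t + A t *m dB).
Proof.
move=> /is_derive_mx derA /is_derive_mx derB; apply/is_derive_mx => i k.
under eq_fun do rewrite mxE.
rewrite !mxE -big_split; apply: is_derive_big_sum => j _.
exact: is_derive_mulr.
Qed.

Lemma is_derive_dot (m n : nat) (A B : R -> 'M[R]_(m, n)) dA dB t :
  is_derive t 1 A dA -> is_derive t 1 B dB ->
  is_derive t 1 (fun s => dot (A s) (B s)) (dot dA (B t) + dot (A t) dB).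
Proof.
move=> /is_derive_mx derA /is_derive_mx derB.
rewrite /dot -big_split; apply: is_derive_big_sum => i _.
rewrite -big_split; apply: is_derive_big_sum => j _.
exact: is_derive_mulr.
Qed.

Lemma is_derive_row (m n : nat) (A : R -> 'M[R]_(m, n)) dA i t :
  is_derive t 1 A dA -> is_derive t 1 (fun s => row i (A s)) (row i dA).
Proof.
move=> /is_derive_mx derA; apply/is_derive_mx => i' j.
by under eq_fun do rewrite mxE; rewrite mxE.
Qed.

Lemma is_derive_edge_error (n l : nat) (x : R -> 'M[R]_(n, l)) dx i q t :
  is_derive t 1 x dx ->
  is_derive t 1 (fun s => edge_error (x s) i q) (edge_error dx i q).
Proof.
by move=> derx; apply: is_deriveB; exact: is_derive_row.
Qed.

Lemma is_derive_laplacian (n : nat) (a : R -> 'M[R]_n) da t :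
  is_derive t 1 a da ->
  is_derive t 1 (fun s => laplacian (a s)) (laplacian da).
Proof.
move=> dera; apply: (is_deriveB _ dera); move/is_derive_mx : dera => dera.
apply/is_derive_mx => i j; under eq_fun do rewrite !mxE.
rewrite !mxE; case: (i == j); rewrite ?mulr1n ?mulr0n.
  by apply: is_derive_big_sum => q _.
exact: is_derive_cst.
Qed.

End derivative_of_matrix_curves.

(** * The storage function and its derivative along curves *)

Section storage_function.
Context {R : realType} {n l : nat}.
Variables (E : rel 'I_n) (d : 'M[R]_n) (M : R).

(** The state p is (x, a, x'). Each edge is counted twice, as in [dot_laplacian]. The constant 1/8
    makes the quartic term differentiate to d/2 |e|^2 e^T e', exactly the part of the drift to be
    cancelled. *)
Definition storage (p : 'M[R]_(n, l) * 'M[R]_n * 'M[R]_(n, l)) : R :=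
  2^-1 * dot p.2 p.2 +
  \sum_i \sum_(q | E i q)
     (d i q / 8 * (dot (edge_error p.1.1 i q) (edge_error p.1.1 i q) ^+ 2) +
      (4 * d i q)^-1 * pos_part_sqr (d i q * M - p.1.2 i q)).

Lemma storage_ge0 p : (forall i q, E i q -> 0 < d i q) -> 0 <= storage p.
Proof.
move=> d_gt0; apply: addr_ge0; first by rewrite mulr_ge0 ?dot_ge0.
apply: sumr_ge0 => i _; apply: sumr_ge0 => q /d_gt0 d0.
by rewrite addr_ge0// mulr_ge0 ?sqr_ge0 ?divr_ge0 ?invr_ge0 ?mulr_ge0// ltW.
Qed.

(** Coordinates of the state are continuous linear maps, and [storage] is built from them by sums,
    products and one composition with [pos_part_sqr]. *)
Lemma continuously_differentiable_storage :
  continuously_differentiable storage.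
Proof.
have state_coord (g : 'M[R]_(n, l) * 'M[R]_n * 'M[R]_(n, l) -> R) :
    linear g -> continuous g -> continuously_differentiable g.
  exact: continuously_differentiable_linear.
have C1x i k : continuously_differentiable
    (fun p : 'M[R]_(n, l) * 'M[R]_n * 'M[R]_(n, l) => p.1.1 i k).
  apply: state_coord => [b p p'|p]; first by rewrite /= !mxE.
  apply: (@cvg_comp _ _ _ (fun p => p.1.1) (fun x : 'M[R]_(n, l) => x i k)).
    by apply: cvg_comp; [exact: cvg_fst|exact: cvg_fst].
  exact: coord_continuous.
have C1a i k : continuously_differentiable
    (fun p : 'M[R]_(n, l) * 'M[R]_n * 'M[R]_(n, l) => p.1.2 i k).
  apply: state_coord => [b p p'|p]; first by rewrite /= !mxE.
  apply: (@cvg_comp _ _ _ (fun p => p.1.2) (fun x : 'M[R]_n => x i k)).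
    by apply: cvg_comp; [exact: cvg_fst|exact: cvg_snd].
  exact: coord_continuous.
have C1v i k : continuously_differentiable
    (fun p : 'M[R]_(n, l) * 'M[R]_n * 'M[R]_(n, l) => p.2 i k).
  apply: state_coord => [b p p'|p]; first by rewrite /= !mxE.
  apply: (@cvg_comp _ _ _ (fun p => p.2) (fun x : 'M[R]_(n, l) => x i k)).
    exact: cvg_snd.
  exact: coord_continuous.
have C1dot (m : nat) (w : 'M[R]_(n, l) * 'M[R]_n * 'M[R]_(n, l) -> 'M[R]_(m, l)) :
    (forall i k, continuously_differentiable (fun p => w p i k)) ->
    continuously_differentiable (fun p => dot (w p) (w p)).
  move=> C1w; apply: continuously_differentiable_sum => i _.
  apply: continuously_differentiable_sum => k _.
  exact: continuously_differentiableM.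
apply: continuously_differentiableD.
  apply: continuously_differentiableM; first exact: continuously_differentiable_cst.
  exact: C1dot.
apply: continuously_differentiable_sum => i _.
apply: continuously_differentiable_sum => q _.
have C1e : continuously_differentiable
    (fun p : 'M[R]_(n, l) * 'M[R]_n * 'M[R]_(n, l) =>
       dot (edge_error p.1.1 i q) (edge_error p.1.1 i q)).
  by apply: C1dot => ? k; under eq_fun do rewrite !mxE; exact: continuously_differentiableB.
apply: continuously_differentiableD.
  apply: continuously_differentiableM; first exact: continuously_differentiable_cst.
  exact: continuously_differentiableM.
apply: continuously_differentiableM; first exact: continuously_differentiable_cst.
apply: (continuously_differentiable_comp (@is_derive_pos_part_sqr R)).
  exact: continuous_double_pos_part.
apply: continuously_differentiableB; last exact: C1a.
exact: continuously_differentiable_cst.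
Qed.

Lemma is_derive_storage (x : R -> 'M[R]_(n, l)) (a : R -> 'M[R]_n)
    (v : R -> 'M[R]_(n, l)) dx da dv (t : R) :
  is_derive t 1 x dx -> is_derive t 1 a da -> is_derive t 1 v dv ->
  is_derive t 1 (fun s => storage (x s, a s, v s))
    (dot (v t) dv +
     \sum_i \sum_(q | E i q)
        (d i q / 2 * dot (edge_error (x t) i q) (edge_error (x t) i q) *
         dot (edge_error (x t) i q) (edge_error dx i q) -
         (2 * d i q)^-1 * Num.max 0 (d i q * M - a t i q) * da i q)).
Proof.
move=> derx dera derv.
apply: is_deriveD.
  apply: (is_derive_eq (is_derive_mulr (is_derive_cst (2^-1 : R) t 1)
    (is_derive_dot derv derv))).
  by rewrite mul0r add0r [dot dv _]dotC /=; field.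
apply: is_derive_big_sum => i _; apply: is_derive_big_sum => q _.
apply: is_deriveD.
  have dere := is_derive_edge_error i q derx.
  have der_sq := is_derive_dot dere dere.
  apply: (is_derive_eq (is_derive_mulr (is_derive_cst (d i q / 8) t 1)
    (is_derive_mulr der_sq der_sq))).
  by rewrite mul0r add0r [dot (edge_error dx i q) _]dotC /=; field.
have derm : is_derive t 1 (fun s => d i q * M - a s i q) (0 - da i q).
  have deraiq : is_derive t 1 (fun s => a s i q) (da i q).
    by move/is_derive_mx : dera; exact.
  exact: (is_deriveB (is_derive_cst (d i q * M) t 1) deraiq).
have dercomp : is_derive t 1 (fun s => pos_part_sqr (d i q * M - a s i q))
    (2 * Num.max 0 (d i q * M - a t i q) * (0 - da i q)).
  have derp := is_derive_pos_part_sqr (d i q * M - a t i q).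
  have dm : derivable (fun s => d i q * M - a s i q) t 1 by exact: ex_derive.
  have dp : derivable (@pos_part_sqr R) (d i q * M - a t i q) 1.
    exact: ex_derive.
  apply: DeriveDef.
    apply/derivable1_diffP.
    apply: (@differentiable_comp _ _ _ _ (fun s => d i q * M - a s i q)
              (@pos_part_sqr R)); exact/derivable1_diffP.
  rewrite -derive1E.
  have := derive1_comp dm dp; rewrite /comp => ->.
  by rewrite !derive1E !derive_val.
apply: (is_derive_eq (is_derive_mulr (is_derive_cst (4 * d i q)^-1 t 1)
  dercomp)).
(* Nothing here says that [d i q] is nonzero. Splitting the inverses and generalizing [(d i q)^-1]
   leaves an identity polynomial in it. *)
rewrite mul0r add0r /= !invfM.
by move: (d i q)^-1 (Num.max _ _) => D m; field.
Qed.

End storage_function.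

(** * The dissipation inequality *)

(** G plays the role of (Hess f) x'. Since [cost] is separable, G is assembled row by row, and its
    product with x' is a sum of terms that are nonnegative by the convexity of each [fi i]. *)
Lemma cost_grad_curve (R : realType) (n l : nat) (fi : 'I_n -> 'rV[R]_l -> R)
    (x : R -> 'M[R]_(n, l)) (dx : 'M[R]_(n, l)) (t : R) :
  (forall i, twice_differentiable (fi i)) ->
  (forall i, strongly_convex (fi i)) ->
  is_derive t 1 x dx ->
  exists2 G : 'M[R]_(n, l),
    is_derive t 1 (fun s => grad (cost fi) (x s)) G & 0 <= dot dx G.
Proof.
move=> fi_diff fi_strong derx.
pose g i (s : R) := grad (fi i) (row i (x s)).
have derrow i : is_derive t 1 (fun s => row i (x s)) (row i dx).
  exact: is_derive_row.
have dg i : derivable (g i) t 1.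
  apply/derivable1_diffP.
  apply: (@differentiable_comp _ _ _ _ (fun s => row i (x s)) (grad (fi i))).
    by apply/derivable1_diffP; exact: (@ex_derive _ _ _ _ _ _ _ (derrow i)).
  exact: (fi_diff i).2.
exists (\matrix_(i, k) 'D_1 (g i) t 0 k).
  apply/is_derive_mx => i k; rewrite mxE.
  under eq_fun do rewrite grad_cost.
  by have /is_derive_mx := derivableP (dg i); exact.
rewrite dot_row; apply: sumr_ge0 => i _.
rewrite (_ : row i (\matrix_(_, _) _) = 'D_1 (g i) t); last first.
  by apply/rowP => k; rewrite !mxE.
have <- : 'D_1 (fun s => row i (x s)) t = row i dx by rewrite derive_val.
apply: convex_dot_derive_grad_ge0.
- exact: (fi_diff i).1.
- exact: strongly_convexW.
- exact: (@ex_derive _ _ _ _ _ _ _ (derrow i)).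
- exact: dg.
Qed.

(* [s], [r], [c] stand for |e|^2, |e'|^2 and e^T e'. *)
Lemma edge_dissipation (R : realType) (d M a s r c : R) :
  0 < d -> 0 <= s -> 0 <= r -> s + r <= M -> - (s + r) / 2 <= c ->
  d / 2 * s * c - (2 * d)^-1 * Num.max 0 (d * M - a) * (d * (s + r)) <=
  2^-1 * (d * (s + r) * c) + 2^-1 * (a * r).
Proof.
move=> d0 s0 r0 srM src.
have -> : (2 * d)^-1 * Num.max 0 (d * M - a) * (d * (s + r)) =
    2^-1 * Num.max 0 (d * M - a) * (s + r).
  by move: (Num.max _ _) => m; field; rewrite gt_eqF.
have m0 : 0 <= Num.max 0 (d * M - a) by rewrite le_max lexx.
(* Only m >= 0 and m >= d M - a are kept about the maximum m. After cancelling the |e|^2 part, twice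
   the gap is d r c + a r + m (s + r), at least d r (c + M) + m s; here c + M >= 0 because c >= - M
   / 2. *)
have m1 : d * M - a <= Num.max 0 (d * M - a) by rewrite le_max lexx orbT.
move: (Num.max _ _) m0 m1 => m m0 m1.
have M0 : 0 <= M by lra.
have cM : 0 <= c + M by lra.
have ms : 0 <= m * s by rewrite mulr_ge0.
have mr : (d * M - a) * r <= m * r by rewrite ler_wpM2r.
have rc : 0 <= d * r * (c + M) by rewrite !mulr_ge0// ltW.
nra.
Qed.

Lemma H1_dissipation (R : realType) (n l : nat) (E : rel 'I_n)
    (fi : 'I_n -> 'rV[R]_l -> R) (d : 'M[R]_n)
    (Omega : set ('rV[R]_l * 'rV[R]_l)) (M t0 t1 : R)
    (z : R -> 'M[R]_(n, l) * 'M[R]_n * 'M[R]_(n, l))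
    (v w : R -> 'M[R]_(n, l)) :
  (forall i, twice_differentiable (fi i)) ->
  (forall i, strongly_convex (fi i)) ->
  (forall i q, E i q -> 0 < d i q) ->
  (forall i q, E i q -> forall p, Omega p -> weight_law 1 p <= M) ->
  H1 E d (cost fi) Omega t0 t1 z v w ->
  forall t, t0 < t < t1 ->
    derive1 (fun s => storage E d M (z s)) t <= dot (v t) (w t).
Proof.
move=> fi_diff fi_strong d_gt0 Omega_le [x [a [u [y [sol inOmega -> -> ->]]]]].
move=> t tI.
(* The equations of a solution hold on an open interval, hence near t, and can be differentiated at
   t. *)
have nearI : \forall s \near t, t0 < s < t1.
  by near=> s; apply/andP; split; near: s; [apply: lt_nbhsr|apply: lt_nbhsl];
    case/andP: tI.
have [[dx da du] a_weights _ law _] := sol t tI.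
have derx := is_derive_derive1 dx.
have dera := is_derive_derive1 da.
have deru := is_derive_derive1 du.
have -> : derive1 y t = derive1 x t.
  rewrite !derive1E; apply: near_eq_derive.
  by apply: filterS nearI => s /sol[].
have [G derG G_ge0] := cost_grad_curve fi_diff fi_strong derx.
have derLx := is_derive_mulmx (is_derive_laplacian dera) derx.
(* A solution is only assumed to be derivable once; x'' exists because the right-hand side of the
   state equation is derivable. *)
have derv : is_derive t 1 (derive1 x)
    (- G - (laplacian (derive1 a t) *m x t + laplacian (a t) *m derive1 x t)
     + derive1 u t).
  apply: (@near_eq_is_derive _ _ _
    (fun s => - grad (cost fi) (x s) - laplacian (a s) *m x s + u s)).
  by apply: filterS nearI => s /sol[].
have daE i q : derive1 a t i q = derive1 (fun s => a s i q) t.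
  by rewrite !derive1E derive_mx// mxE.
have deE i q : derive1 (fun s => edge_error (x s) i q) t =
    edge_error (derive1 x t) i q.
  rewrite derive1E.
  exact: (@derive_val _ _ _ _ _ _ _ (is_derive_edge_error i q derx)).
have da_edge i q : E i q -> derive1 a t i q =
    d i q * (dot (edge_error (x t) i q) (edge_error (x t) i q) +
             dot (edge_error (derive1 x t) i q) (edge_error (derive1 x t) i q)).
  by move=> Eiq; rewrite daE law// /weight_law/= deE.
(* [dot_laplacian] is also applied to a'. Its symmetry, and below its vanishing off the edges, are
   inherited from the weights at times near t. *)
have da_sym i q : derive1 a t i q = derive1 a t q i.
  rewrite !daE !derive1E; apply: near_eq_derive.
  by apply: filterS nearI => s /sol[_ [asym _ _] _ _ _]; exact: asym.
have da_nonedge i q : ~~ E i q -> derive1 a t i q = 0.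
  move=> nEiq; rewrite daE derive1E -[RHS](derive_cst (0 : R) t 1).
  apply: near_eq_derive.
  by apply: filterS nearI => s /sol[_ [_ _ a0] _ _ _]; exact: a0.
have [a_sym _ a_nonedge] := a_weights.
have edge_sum (b : 'M[R]_n) (c : 'I_n -> 'I_n -> R) :
    (forall i q, ~~ E i q -> b i q = 0) ->
    \sum_i \sum_q b i q * c i q = \sum_i \sum_(q | E i q) b i q * c i q.
  move=> b0; apply: eq_bigr => i _; rewrite [RHS]big_mkcond.
  by apply: eq_bigr => q _; case: ifPn => // /b0->; rewrite mul0r.
rewrite derive1E (@derive_val _ _ _ _ _ _ _ (is_derive_storage E d M derx dera derv)).
rewrite !(dotDr, dotNr) !dot_laplacian// !edge_sum// [dot _ (derive1 u t)]dotC.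
set S1 := \sum_i _; set S2 := \sum_i _; set S := \sum_i _.
(* The supply rate u'^T x' occurs on both sides and G contributes with a favourable sign. What
   remains compares S, from the edge terms of the storage, with the forms of L' (S1) and L (S2), and
   is proved edge by edge. *)
suff : S <= 2^-1 * S1 + 2^-1 * S2 by move: G_ge0; lra.
rewrite /S /S1 /S2 !mulr_sumr -big_split; apply: ler_sum => i _ /=.
rewrite !mulr_sumr -big_split; apply: ler_sum => q Eiq /=.
rewrite da_edge// [dot (edge_error (derive1 x t) i q) (edge_error (x t) i q)]dotC.
apply: edge_dissipation; rewrite ?dot_ge0 ?d_gt0 ?dot_lower_bound//.
have := Omega_le i q Eiq _ (inOmega t tI i q Eiq).
by rewrite /weight_law mul1r /= deE.
Unshelve. all: by end_near. Qed.

Theorem proposition2p1 (R : realType) (n l : nat)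
    (E : rel 'I_n) (graphE : undirected_graph E) (connE : connected_graph E)
    (a0 : 'M[R]_n) (a0_weights : coupling_weights E a0)
    (fi : 'I_n -> 'rV[R]_l -> R)
    (fi_diff : forall i, twice_differentiable (fi i))
    (fi_strong : forall i, strongly_convex (fi i))
    (g : nat -> R -> R) (mg : 'I_n -> 'I_l -> nat)
    (g_convex : forall i k (j : 'I_(mg i k)),
       convex_function (setT : set R^o) (g j))
    (g_diff : forall i k (j : 'I_(mg i k)) (s : R), derivable (g j) s 1)
    (slater_cond : slater g mg)
    (f_strict : strictly_convex (cost fi))
    (d : 'M[R]_n)
    (d_sym : forall i q, E i q -> d i q = d q i)
    (d_gt0 : forall i q, E i q -> 0 < d i q)
    (Omega : set ('rV[R]_l * 'rV[R]_l))
    (law_lipschitz : forall i q, E i q ->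
       [lipschitz weight_law (d i q) p | p in Omega])
    (xeq : 'M[R]_(n, l))
    (kkt : exists alpha theta, KKT E a0 fi g mg xeq alpha theta) :
  passive (H1 E d (cost fi) Omega) (H1_rest E xeq).
Proof.
(* [weight_law 1] and [Omega] do not depend on the edge, so a bound obtained from any one edge
   serves for all; without edges there is nothing to bound. *)
have [M M0 Omega_le] : exists2 M : R, 0 <= M &
    forall i q, E i q -> forall p, Omega p -> weight_law 1 p <= M.
  have [[i [q Eiq]]|noE] := pselect (exists i q, E i q); last first.
    by exists 0 => // i q Eiq; case: noE; exists i, q.
  have [M M0 OM] := weight_law_lipschitz_bounded (d_gt0 i q Eiq)
    (law_lipschitz i q Eiq).
  by exists M => // i' q' _.
exists (storage E d M); split.
- exact: continuously_differentiable_storage.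
- by move=> p; exact: storage_ge0.
(* Adding 1 to d M keeps the weights positive even when M = 0, and they exceed the threshold beyond
   which the positive part vanishes. *)
- pose a : 'M[R]_n := \matrix_(i, q) (if E i q then d i q * M + 1 else 0).
  have [Esym _] := graphE.
  exists (xeq, a, 0); first split=> //.
    split=> i q; rewrite !mxE.
    + by rewrite Esym; case: ifP => // Eqi; rewrite d_sym// Esym.
    + by move=> Eiq; rewrite Eiq ltr_wpDl// mulr_ge0// ltW// d_gt0.
    + by move=> /negbTE ->.
  (* The consensus condition of the KKT point makes every edge error vanish, and with it the quartic
     term. *)
  have [alpha [theta [_ _ _ _ consensus]]] := kkt.
  rewrite /storage dot0l mulr0 add0r big1// => i _; rewrite big1// => q Eiq.
  rewrite /= (_ : edge_error xeq i q = 0); last first.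
    by apply/rowP => k; rewrite !mxE (consensus i q k) subrr.
  rewrite dot0l mxE Eiq /pos_part_sqr max_l ?expr0n ?mulr0 ?addr0//.
  lra.
- by move=> t0 t1 z v w; exact: H1_dissipation.
Qed.
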